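(* Let $\Phi:\mathbb{K}\to[0,\infty)$ be a function with $\Phi(\hat1)=0$. There exists a unique Radon measure $\lambda$ on $\mathcal{F}'=\mathcal{F}\setminus\{\mathbb{K}\}$ such that $\Phi(x)=\lambda(\mathcal{F}^x)$ for all $x\in\mathbb{K}$, where $\mathcal{F}^x=\{V\in\mathcal{F}: x\notin V\}$, if and only if $\Phi$ is a completely alternating conjugate Scott function.
   Context: A dcpo is a poset in which every (nonempty) directed subset has a supremum. In a dcpo, $x\ll y$ means that every directed $E$ with $y\le\sup E$ contains some $w$ with $x\le w$. A domain is a dcpo in which, for each $x$, the set $\{z: z\ll x\}$ is a directed lower set with supremum $x$. A subset $U$ is Scott open if it is an upper set and meets every directed $E$ with $\sup E\in U$. The Lawson topology has as subbase the Scott open sets together with the complements of the principal upper sets $\{z: x\le z\}$. $\mathbb{K}$ is a domain which is also a lattice with top element $\hat1$, such that $\hat1\ll\hat1$ and $\ll$ is multiplicative: $a\ll x$, $b\ll y$ imply $a\wedge b\ll x\wedge y$. $\mathcal{F}=\mathrm{OFilt}(\mathbb{K})$ is the set of Scott open filters (nonempty, down-directed Scott open sets) of $\mathbb{K}$ ordered by inclusion; it is a continuous lattice whose Lawson topology is compact Hausdorff (with subbase the sets $\{V\in\mathcal{F}:x\in V\}$, $x\in\mathbb{K}$, and $\{W\in\mathcal{F}: V\not\subseteq W\}$, $V\in\mathcal{F}$). $\mathcal{F}'=\mathcal{F}\setminus\{\mathbb{K}\}$ with the subspace topology is locally compact Hausdorff. A Radon measure is a Borel measure, finite on compact sets, inner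 regular on open sets and outer regular on Borel sets. A conjugate Scott function (conjugate) is a function $\Phi:\mathbb{K}\to[0,\infty)$ with $\Phi(x)=\inf_{z\ll x}\Phi(z)$ for all $x$ (in particular decreasing, not necessarily bounded), normalized by $\Phi(\hat1)=0$. For $z\in\mathbb{K}$ put $\nabla_z\Phi(x)=\Phi(x)-\Phi(x\wedge z)$ and $\nabla_{z_1,\ldots,z_n}\Phi=\nabla_{z_n}(\nabla_{z_1,\ldots,z_{n-1}}\Phi)$; this depends only on $A=\{z_1,\ldots,z_n\}$ and is denoted $\nabla_A\Phi$. A decreasing $\Phi$ is completely alternating if $\nabla_A\Phi\le0$ for every nonempty finite $A\subseteq\mathbb{K}$. *)

(* Defs.v *)
From HB Require Import structures.
From mathcomp Require Import all_boot all_order all_algebra.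
From mathcomp Require Import finmap.
From mathcomp Require Import all_classical all_reals all_analysis.

Set Implicit Arguments.
Unset Strict Implicit.
Unset Printing Implicit Defensive.
Import Order.TTheory GRing.Theory Num.Theory.
Import numFieldNormedType.Exports.

Local Open Scope classical_set_scope.
Local Open Scope ring_scope.

Section Domains.
Context {d : Order.disp_t} {P : porderType d}.
Implicit Types (E U : set P) (x y z : P).

Definition directed E : Prop :=
  E !=set0 /\ forall a b, E a -> E b -> exists c, [/\ E c, (a <= c)%O & (b <= c)%O].

Definition codirected E : Prop :=
  forall a b, E a -> E b -> exists c, [/\ E c, (c <= a)%O & (c <= b)%O].

Definition upper_set U : Prop := forall x y, U x -> (x <= y)%O -> U y.

Definition lower_set U : Prop := forall x y, U y -> (x <= y)%O -> U x.

Definition way_below x y : Prop :=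
  forall E s, directed E -> isLub E s -> (y <= s)%O -> exists2 w, E w & (x <= w)%O.

Definition scott_open U : Prop :=
  upper_set U /\ forall E s, directed E -> isLub E s -> U s -> E `&` U !=set0.

Definition open_filter U : Prop := [/\ U !=set0, codirected U & scott_open U].

Definition lawson_subbase : set (set P) :=
  [set U | scott_open U \/ exists x, U = ~` [set z | (x <= z)%O]].

End Domains.

Definition is_dcpo {d} (P : porderType d) : Prop :=
  forall E : set P, directed E -> exists s, isLub E s.

Definition is_domain {d} (P : porderType d) : Prop :=
  is_dcpo P /\
  forall x : P, [/\ directed [set z | way_below z x],
                    lower_set [set z | way_below z x]
                  & isLub [set z | way_below z x] x].

Definition multiplicative_way_below {d} (K : latticeType d) : Prop :=
  forall a b x y : K, way_below a x -> way_below b y ->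
    way_below (Order.meet a b) (Order.meet x y).

Definition lawson (T : Type) : Type := T.

Section LawsonTopology.
Context {d : Order.disp_t} (P : porderType d).
HB.instance Definition _ := Order.POrder.on (lawson P).
HB.instance Definition _ := isSubBaseTopological.Build (lawson P)
  (@lawson_subbase d P) id.

Lemma lawson_openE (U : set (lawson P)) :
  open U = exists2 D : set (set P),
    D `<=` finI_from (@lawson_subbase d P) id & \bigcup_(V in D) V = U.
Proof. by []. Qed.
End LawsonTopology.

Record OFilt {d} (K : porderType d) := MkOFilt {
  ofilt_set :> set K ;
  ofilt_setP : `[< open_filter ofilt_set >] }.

Section OFiltOrder.
Context {d : Order.disp_t} (K : porderType d).
HB.instance Definition _ := [isSub for @ofilt_set d K].
HB.instance Definition _ := [Choice of OFilt K by <:].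
HB.instance Definition _ :=
  [SubChoice_isSubPOrder of OFilt K by <: with set_display].

Lemma OFilt_leE (V W : OFilt K) :
  (V <= W)%O <-> (V : set K) `<=` (W : set K).
Proof. by rewrite -subsetEset. Qed.

(* The open filters other than K itself, i.e. other than setT. *)
Definition OFilt' : Type :=
  [set V : lawson (OFilt K) | (V : OFilt K) <> setT :> set K].

End OFiltOrder.

HB.instance Definition _ {d : Order.disp_t} (K : porderType d) :=
  Topological.on (OFilt' K).

Lemma open_OFilt'E {d : Order.disp_t} (K : porderType d) (U : set (OFilt' K)) :
  open U = exists2 V : set (lawson (OFilt K)), open V & set_val @^-1` V = U.
Proof. by []. Qed.

Definition ofilt_avoid {d} {K : porderType d} (x : K) : set (OFilt K) :=
  [set V | ~ (V : set K) x].

(* No open filter is lost here: one that misses x is not setT. *)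
Definition ofilt'_avoid {d} {K : porderType d} (x : K) : set (OFilt' K) :=
  set_val @^-1` (ofilt_avoid x : set (lawson (OFilt K))).

Lemma image_ofilt'_avoid {d} {K : porderType d} (x : K) :
  set_val @` ofilt'_avoid x = (ofilt_avoid x : set (lawson (OFilt K))).
Proof.
apply/seteqP; split => [_ [V Vx <-] //|V Vx].
have VT : V \in [set V : lawson (OFilt K) | (V : OFilt K) <> setT :> set K].
  by apply/mem_set => /= VT; apply: Vx; rewrite VT.
by exists (exist _ V VT).
Qed.

Section RadonMeasures.
Context {R : realType} {T : topologicalType}.
Implicit Types (mu : set T -> \bar R) (A B C U : set T).
Local Open Scope ereal_scope.

Definition borel : set (set T) := <<s @open T >>.

(* The library's measures live on pointed types only, whereas OFilt' K is empty
   when K is a singleton; [borel_measureP] below gives the agreement on pointed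
   types. The values of [mu] outside the Borel sets are irrelevant. *)
Definition borel_measure mu : Prop :=
  [/\ mu set0 = 0, (forall A, borel A -> 0 <= mu A)
    & forall F : (set T)^nat, (forall n, borel (F n)) -> trivIset setT F ->
        \sum_(0 <= i < n) mu (F i) @[n --> \oo] --> mu (\bigcup_n F n)].

Definition radon_measure mu : Prop :=
  [/\ borel_measure mu,
      (forall C, compact C -> mu C < +oo),
      (forall U, open U ->
         mu U = ereal_sup [set mu C | C in [set C | compact C /\ C `<=` U]])
    & (forall B, borel B ->
         mu B = ereal_inf [set mu U | U in [set U | open U /\ B `<=` U]])].

End RadonMeasures.

Lemma borel_measureP {R : realType} (T : ptopologicalType)
    (mu : set T -> \bar R) :
  borel_measure mu <->
  exists m : {measure set (g_sigma_algebraType (@open T)) -> \bar R},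
    forall A, borel A -> mu A = m A.
Proof.
have b0 : borel (@set0 T) by exact: sigma_algebra0.
split => [[mu0 mu_ge0 muS]|[m mE]]; last first.
  split => [|A bA|F bF tF]; first by rewrite mE// measure0.
    by rewrite mE// measure_ge0.
  rewrite (mE (\bigcup_n F n)); last exact: sigma_algebra_bigcup.
  under eq_fun do under eq_bigr do rewrite mE//.
  apply: measure_semi_sigma_additive => //.
  exact: sigma_algebra_bigcup.
pose nu (A : set (g_sigma_algebraType (@open T))) : \bar R :=
  if pselect (borel (A : set T)) then mu A else 0%E.
have nuE A : borel A -> nu A = mu A by rewrite /nu; case: pselect.
have nu0 : nu set0 = 0%E by rewrite nuE.
have nu_ge0 A : (0 <= nu A)%E.
  by rewrite /nu; case: pselect => //; exact: mu_ge0.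
have nuS : semi_sigma_additive nu.
  move=> F mF tF mUF; rewrite nuE//.
  under eq_fun do under eq_bigr do rewrite (nuE _ (mF _)).
  exact: muS.
pose m := isMeasure.Build _ _ _ nu nu0 nu_ge0 nuS.
pose M : {measure set (g_sigma_algebraType (@open T)) -> \bar R} :=
  HB.pack nu m.
by exists M => A bA; rewrite /= nuE.
Qed.

Section Alternating.
Context {R : realType} {d : Order.disp_t} {K : tLatticeType d}.
Implicit Types (Phi : K -> R) (s t : seq K) (A : {fset K}).

Definition nabla Phi (z : K) : K -> R := fun x => Phi x - Phi (Order.meet x z).

Definition nablas Phi s : K -> R := foldl nabla Phi s.

Lemma nablaC Phi y z : nabla (nabla Phi y) z = nabla (nabla Phi z) y.
Proof.
apply/funext => x; rewrite /nabla (meetAC x z y).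
by rewrite !opprB [LHS]addrACA [RHS]addrACA; congr (_ + _); exact: addrC.
Qed.

Lemma nablaK Phi z : nabla (nabla Phi z) z = nabla Phi z.
Proof. by apply/funext => x; rewrite /nabla -meetA meetxx subrr subr0. Qed.

Lemma nablas_nabla Phi s z : nablas (nabla Phi z) s = nabla (nablas Phi s) z.
Proof. by elim: s Phi => //= y s IH Phi; rewrite nablaC IH. Qed.

Lemma nablas_in Phi s z : z \in s -> nabla (nablas Phi s) z = nablas Phi s.
Proof.
elim: s Phi => //= y s IH Phi; rewrite inE => /predU1P[->|/IH//].
by rewrite nablas_nabla nablaK.
Qed.

Lemma nablas_undup Phi s : nablas Phi (undup s) = nablas Phi s.
Proof.
elim: s Phi => //= y s IH Phi; case: ifP => [ys|_] /=; last by rewrite IH.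
by rewrite IH nablas_nabla nablas_in.
Qed.

Lemma nablas_perm Phi s t : perm_eq s t -> nablas Phi s = nablas Phi t.
Proof.
elim: s t Phi => [|y s IH] t Phi; first by move=> /[1!perm_sym]/perm_nilP->.
move=> st; have /splitPr yt : y \in t by rewrite -(perm_mem st) mem_head.
case: yt st => t1 t2 /[1!perm_sym]; rewrite -cat1s perm_catCA /= perm_cons.
move=> /[1!perm_sym] st; rewrite [LHS]/= (IH _ _ st) /nablas !foldl_cat /=.
by rewrite -/(nablas _ t1) -/(nablas Phi t1) nablas_nabla.
Qed.

Lemma nablas_eq_mem Phi s t : s =i t -> nablas Phi s = nablas Phi t.
Proof.
move=> st; rewrite -[LHS]nablas_undup -[RHS]nablas_undup; apply: nablas_perm.
by apply: uniq_perm; rewrite ?undup_uniq// => x; rewrite !mem_undup.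
Qed.

(* By [nablas_eq_mem] the enumeration of A chosen here does not matter. *)
Definition nabla_fset Phi A : K -> R := nablas Phi (enum_fset A).

Definition conjugate_scott Phi : Prop :=
  [/\ forall x, 0 <= Phi x,
      forall x, Phi x = inf [set Phi z | z in [set z | way_below z x]]
    & Phi \top%O = 0].

Definition completely_alternating Phi : Prop :=
  (forall x y, (x <= y)%O -> Phi y <= Phi x) /\
  forall A, A != fset0 -> forall x, nabla_fset Phi A x <= 0.

End Alternating.

(* Main.v *)
(* Write F^x for [ofilt'_avoid x]. Sets (F^z1 & ... & F^zn) \ F^x, called cells
   here, form a neighbourhood basis of F', and any measure giving mass Phi x to
   each F^x gives such a cell mass - nabla_{z1..zn} Phi x; hence Phi is
   completely alternating, and inclusion-exclusion over finite unions of cells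
   squeezed between a compact set and an open one yields uniqueness.

   For existence, let s be a finite list in K. Moebius inversion gives a
   nonnegative combination of point masses at meets a of elements of s, which
   charges {a | ~ a <= x} with mass Phi x for each x in s. Send a to the open
   filter {x | a << x} and take the limit along an ultrafilter of lists s. The
   result is a finitely additive set function whose value on F^x is squeezed
   between Phi x and Phi z for all z << x. Its restriction to compact sets is a
   content in the sense of Halmos, and the Radon measure induced by this content
   is the one sought. *)
From HB Require Import structures.
Require Import Defs.
From mathcomp Require Import all_boot all_order all_algebra.
From mathcomp Require Import finmap.
From mathcomp Require Import all_classical all_reals all_analysis.
Set Implicit Arguments.
Unset Strict Implicit.
Unset Printing Implicit Defensive.
Import Order.TTheory GRing.Theory Num.Theory.
Import numFieldNormedType.Exports.
Local Open Scope classical_set_scope.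
Local Open Scope ring_scope.

(** * Domains and open filters *)

Section WayBelow.
Context {d : Order.disp_t} {P : porderType d}.
Implicit Types x y z : P.

Lemma way_below_le x y : way_below x y -> (x <= y)%O.
Proof.
move=> /(_ [set y] y) [| |//|_ -> //].
- split; first by exists y.
  by move=> _ _ -> ->; exists y.
- by split=> [_ ->//|b]; exact.
Qed.

Lemma way_below_le_trans x y z : way_below x y -> (y <= z)%O -> way_below x z.
Proof. by move=> xy yz E s dE sE /(le_trans yz); exact: xy. Qed.

Lemma le_way_below_trans x y z : (x <= y)%O -> way_below y z -> way_below x z.
Proof.
move=> xy yz E s dE sE zs; have [w Ew yw] := yz E s dE sE zs.
by exists w => //; exact: le_trans yw.
Qed.

Hypothesis domP : is_domain P.

(** The set [E] of all [w] with an intermediate [y] is directed and has supremum [x], so [z] lies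
    below one of its elements. *)
Lemma way_below_interpolation x z : way_below z x ->
  exists2 y, way_below z y & way_below y x.
Proof.
move=> zx; have [_ domP2] := domP.
pose E := [set w | exists2 y, way_below w y & way_below y x].
have [w [y wy yx] zw] : exists2 w, E w & (z <= w)%O.
  apply: (zx E x) => //; first split.
  - have [[[y yx] _] _ _] := domP2 x; have [[[w wy] _] _ _] := domP2 y.
    by exists w, y.
  - move=> a b [y1 ay1 y1x] [y2 by2 y2x].
    have [[_ /(_ _ _ y1x y2x)[y [yx y1y y2y]]] _ _] := domP2 x.
    have [[_ dy] _ _] := domP2 y.
    have [c [cy ac bc]] := dy a b (way_below_le_trans ay1 y1y)
                                  (way_below_le_trans by2 y2y).
    by exists c; split=> //; exists y.
  - split=> [w [y /way_below_le wy /way_below_le]|b Eb]; first exact: le_trans.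
    have [_ _ [_]] := domP2 x; apply => y yx.
    have [_ _ [_]] := domP2 y; apply => w wy.
    by apply: Eb; exists y.
by exists y => //; exact: le_way_below_trans wy.
Qed.

Lemma scott_open_way_below (U : set P) x : scott_open U -> U x ->
  exists2 z, U z & way_below z x.
Proof.
move=> [_ sU] Ux; have [_ /(_ x)[dx _ lx]] := domP.
by have [z [zx Uz]] := sU _ _ dx lx Ux; exists z.
Qed.

Lemma scott_open_way_above x : scott_open [set y | way_below x y].
Proof.
split=> [y z xy yz|E s dE sE /= xs]; first exact: way_below_le_trans yz.
have [y xy ys] := way_below_interpolation xs.
have [w Ew yw] := ys E s dE sE (lexx s).
by exists w; split=> //=; exact: way_below_le_trans yw.
Qed.

End WayBelow.

Section OpenFilters.
Context {d : Order.disp_t} {K : tLatticeType d}.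
Hypotheses (domK : is_domain K) (topK : way_below (\top%O : K) (\top%O : K))
  (mulK : multiplicative_way_below K).
Implicit Types (x y z : K) (V W : OFilt K).

Lemma ofilt_top V : (V : set K) \top%O.
Proof.
have /asboolP[[x Vx] _ [uV _]] := ofilt_setP V.
exact: uV Vx (lex1 x).
Qed.

Lemma ofilt_upper V x y : (V : set K) x -> (x <= y)%O -> (V : set K) y.
Proof. by have /asboolP[_ _ [uV _]] := ofilt_setP V => /uV; apply. Qed.

Lemma ofilt_meet V x y :
  (V : set K) (Order.meet x y) <-> (V : set K) x /\ (V : set K) y.
Proof.
split=> [Vxy|[Vx Vy]].
  by split; apply: ofilt_upper Vxy _; rewrite (leIl, leIr).
have /asboolP[_ /(_ _ _ Vx Vy)[c [Vc cx cy]] _] := ofilt_setP V.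
by apply: ofilt_upper Vc _; rewrite lexI cx.
Qed.

Lemma ofilt_way_below V x : (V : set K) x ->
  exists2 z, (V : set K) z & way_below z x.
Proof.
by have /asboolP[_ _ sV] := ofilt_setP V; exact: scott_open_way_below.
Qed.

(* Multiplicativity of the way-below relation is what makes this a filter. *)
Lemma open_filter_interior (L : set K) :
  L \top%O -> (forall x y, L x -> L y -> L (Order.meet x y)) ->
  open_filter [set x : K | exists2 z, L z & way_below z x].
Proof.
move=> L1 LI; split; first by exists \top%O, \top%O.
- move=> x y [a La ax] [b Lb yb]; exists (Order.meet x y).
  split; rewrite ?leIl ?leIr//.
  by exists (Order.meet a b); [exact: LI|exact: mulK].
- split=> [x y [a La ax] xy|E s dE sE [a La /= as_]].
    by exists a => //; exact: way_below_le_trans xy.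
  have [_ /(_ _ _ dE sE as_)[w [Ew aw]]] := scott_open_way_above domK a.
  by exists w; split=> //; exists a.
Qed.

(** When [L] is also an upper set, this is the largest open filter inside [L]; it provides the
    limits of ultrafilters in the compactness proof below. *)
Definition ofilt_interior (L : set K) (L1 : L \top%O)
    (LI : forall x y, L x -> L y -> L (Order.meet x y)) : OFilt K :=
  MkOFilt (asboolT (open_filter_interior L1 LI)).

(** Nonemptiness rests on [topK], since [a] is below the top; closure under meets is [mulK] with [a]
    used twice on the left. Every open filter is the directed supremum of such filters. *)
Lemma open_filter_way_above a : open_filter [set x : K | way_below a x].
Proof.
split; last exact: scott_open_way_above.
- by exists \top%O; apply: le_way_below_trans topK; exact: lex1.
- move=> x y ax ay; exists (Order.meet x y).
  split; rewrite ?leIl ?leIr//=.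
  by rewrite -(meetxx a); exact: mulK.
Qed.

Definition way_above a : OFilt K := MkOFilt (asboolT (open_filter_way_above a)).

End OpenFilters.

(** * From contents on compact sets to Radon measures *)

(** The sets [A] with [P (C \ A)] form a filter containing [C]. If [P C] fails, the filter is proper
    and clusters at some [p] in [C], but it contains the complement of a neighbourhood of [p]. *)
Lemma compact_induction (T : topologicalType) (P : set T -> Prop) (C : set T) :
  (forall A B, A `<=` B -> P B -> P A) -> P set0 ->
  (forall A B, P A -> P B -> P (A `|` B)) ->
  (forall p, C p -> exists2 N, nbhs p N & P N) ->
  compact C -> P C.
Proof.
move=> PS P0 PU PC cC; apply: contrapT => nPC.
pose F : set_system T := [set A | P (C `\` A)].
have FF : ProperFilter F.
  split; first by rewrite /F /= setD0.
  split; rewrite /F /=.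
  - by rewrite setDT.
  - move=> A B PA PB; rewrite /= setDIr; exact: PU.
  - by move=> A B AB; apply: PS; exact: setDS.
have FC : F C by rewrite /F /= setDv.
have [p [Cp clp]] := cC F FF FC.
have [N Np PN] := PC p Cp.
have FN : F (~` N) by apply: PS PN => x [_ /contrapT].
by have [x []] := clp _ _ FN Np.
Qed.

Section ContentExtension.
Context {R : realType} {T : topologicalType}.
Hypotheses (hausT : hausdorff_space T)
  (lcT : forall p : T, exists2 C : set T, compact C & nbhs p C).
Variable m : set T -> R.
Hypotheses (m_ge0 : forall C, compact C -> 0 <= m C)
  (m_le : forall C D, compact C -> compact D -> C `<=` D -> m C <= m D)
  (mU_le : forall C D, compact C -> compact D -> m (C `|` D) <= m C + m D)
  (mU : forall C D, compact C -> compact D -> C `&` D = set0 ->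
    m (C `|` D) = m C + m D).
Implicit Types A B C D U W : set T.

Lemma compact_nbhs_sub p U : open U -> U p ->
  exists C, [/\ compact C, nbhs p C & C `<=` U].
Proof.
move=> oU Up; have [C cC nC] := lcT p.
have [N nN NU] := compact_regular hausT cC nC (open_nbhs_nbhs (conj oU Up)).
exists (C `&` closure N); split.
- by apply: compact_closedI => //; exact: closed_closure.
- by apply: filterI => //; apply: filterS nN; exact: subset_closure.
- by move=> x [_ /NU].
Qed.

(** Each point of [C] has a compact neighbourhood inside a single [U i]; compact induction merges
    such pieces index by index. *)
Lemma compact_split C (U : (set T)^nat) : compact C -> (forall n, open (U n)) ->
  C `<=` \bigcup_n U n ->
  exists n (D : (set T)^nat),
    (forall i, compact (D i) /\ D i `<=` U i) /\ C `<=` \bigcup_(i < n) D i.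
Proof.
move=> cC oU CU.
apply: (@compact_induction _ (fun A => exists n (D : (set T)^nat),
    (forall i, compact (D i) /\ D i `<=` U i) /\ A `<=` \bigcup_(i < n) D i))
  cC => [A B AB [n [D [DU BD]]]|
        |A B [n [D [DU AD]]] [k [E [EU BE]]]|p /CU[i _ Uip]].
- by exists n, D; split=> //; exact: subset_trans BD.
- by exists 0%N, (fun=> set0); split=> // i; split=> //; exact: compact0.
- exists (n + k)%N, (fun i => D i `|` E i); split=> [i|x].
    split; first by apply: compactU; [have [] := DU i|have [] := EU i].
    by move=> x [/(DU i).2|/(EU i).2].
  move=> [/AD|/BE] [i /= ik xi].
    by exists i; [exact: leq_trans ik (leq_addr _ _)|left].
  by exists i; [exact: leq_trans ik (leq_addl _ _)|right].
- have [D [cD nD DU]] := compact_nbhs_sub (oU i) Uip.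
  exists D => //; exists i.+1, (fun j => if j == i then D else set0).
  split=> [j|x Dx]; last by exists i => /=; rewrite ?eqxx//.
  by case: ifPn => [/eqP->//|_]; split=> //; exact: compact0.
Qed.

Local Open Scope ereal_scope.

(** Halmos's inner content, intended for open sets; the outer measure of an arbitrary set is then
    the infimum over its open supersets. *)
Definition inner_content U : \bar R :=
  ereal_sup [set (m C)%:E | C in [set C | compact C /\ C `<=` U]].

Definition outer_content A : \bar R :=
  ereal_inf [set inner_content U | U in [set U | open U /\ A `<=` U]].

Lemma inner_content_ge C U : compact C -> C `<=` U ->
  (m C)%:E <= inner_content U.
Proof. by move=> cC CU; apply: ereal_sup_ubound; exists C. Qed.

Lemma inner_content_le U W : U `<=` W -> inner_content U <= inner_content W.
Proof.
move=> UW; apply: ereal_sup_le => _ [C [cC CU] <-].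
by exists C => //; split=> //; exact: subset_trans UW.
Qed.

Lemma inner_content_ge0 U : 0 <= inner_content U.
Proof.
apply: le_trans (inner_content_ge compact0 (@sub0set _ U)).
by rewrite lee_fin m_ge0//; exact: compact0.
Qed.

Lemma content0 : m set0 = 0%R.
Proof.
have := mU (compact0 (T := T)) compact0 (setI0 _).
by rewrite setU0 => /eqP; rewrite -subr_eq0 opprD addNKr oppr_eq0 => /eqP.
Qed.

Lemma outer_content_open U : open U -> outer_content U = inner_content U.
Proof.
move=> oU; apply/eqP; rewrite eq_le; apply/andP; split.
  by apply: ereal_inf_lbound; exists U => //; split.
by apply: le_ereal_inf_tmp => _ [W [_ UW] <-]; exact: inner_content_le.
Qed.

Lemma outer_content_le A B : A `<=` B -> outer_content A <= outer_content B.
Proof.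
move=> AB; apply: ereal_inf_le_tmp => _ [W [oW BW] <-].
by exists W => //; split=> //; exact: subset_trans BW.
Qed.

Lemma outer_content_ge0 A : 0 <= outer_content A.
Proof. by apply: le_ereal_inf_tmp => _ [W _ <-]; exact: inner_content_ge0. Qed.

Lemma content_bigsetU n (D : (set T)^nat) : (forall i, compact (D i)) ->
  compact (\big[setU/set0]_(i < n) D i) /\
  (m (\big[setU/set0]_(i < n) D i) <= \sum_(i < n) m (D i))%R.
Proof.
move=> cD; elim: n => [|n [IHc IHm]].
  by rewrite !big_ord0 content0; split=> //; exact: compact0.
rewrite !big_ord_recr /=; split; first exact: compactU.
by apply: le_trans (mU_le IHc (cD n)) _; rewrite lerD2r.
Qed.

Lemma inner_content_sigma_subadditive (U : (set T)^nat) :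
  (forall n, open (U n)) ->
  inner_content (\bigcup_n U n) <= \sum_(i <oo) inner_content (U i).
Proof.
move=> oU; apply: ge_ereal_sup => _ [C [cC CU] <-].
have [n [D [DU CD]]] := compact_split cC oU CU.
have [cDn mDn] := content_bigsetU n (fun i => (DU i).1).
apply: (@le_trans _ _ (\sum_(0 <= i < n) inner_content (U i))); last first.
  by apply: nneseries_lim_ge => i _ _; exact: inner_content_ge0.
rewrite big_mkord.
apply: (@le_trans _ _ (\sum_(i < n) (m (D i))%:E)); last first.
  by apply: lee_sum => i _; apply: inner_content_ge; have [] := DU i.
rewrite sumEFin lee_fin; apply: le_trans mDn; apply: m_le => //.
by rewrite -bigcup_mkord.
Qed.

Lemma outer_content_sigma_subadditive : sigma_subadditive outer_content.
Proof.
move=> A; have [[i ioo]|] := pselect (exists i, outer_content (A i) = +oo).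
  rewrite (eseries_pinfty _ _ ioo) ?leey// => n _.
  by rewrite -ltNye (lt_le_trans _ (outer_content_ge0 _)).
rewrite -forallNE => Aoo.
apply/lee_addgt0Pr => e e0.
(* Each [A n] gets an open superset exceeding its outer content by at most [e / 2 ^ n.+1]; these
   errors sum to at most [e]. *)
apply: le_trans (epsilon_trick _ _ (ltW e0)); last first.
  by move=> n; exact: outer_content_ge0.
have [U PU] : {U : (set T)^nat & forall n, [/\ open (U n), A n `<=` U n &
    inner_content (U n) <= outer_content (A n) + (e / (2 ^ n.+1)%:R)%:E]}.
  apply: (@choice _ _ (fun n W => [/\ open W, A n `<=` W &
    inner_content W <= outer_content (A n) + (e / (2 ^ n.+1)%:R)%:E])) => n.
  have en : (0 < e / (2 ^ n.+1)%:R :> R)%R.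
    by rewrite divr_gt0// ltr0n expn_gt0.
  have fA : outer_content (A n) \is a fin_num.
    rewrite ge0_fin_numE; last exact: outer_content_ge0.
    by rewrite ltey; apply/eqP; exact: Aoo.
  have [_ [W [oW AW] <-] We] := lb_ereal_inf_adherent en fA.
  by exists W; split=> //; exact: ltW.
apply: (@le_trans _ _ (\sum_(i <oo) inner_content (U i))).
  have oU n : open (U n) by have [] := PU n.
  apply: le_trans (inner_content_sigma_subadditive oU).
  apply: ereal_inf_lbound; exists (\bigcup_n U n) => //; split.
    by apply: bigcup_open.
  by apply: subset_bigcup => i _; have [] := PU i.
apply: lee_nneseries => [i _ _|n _]; first exact: inner_content_ge0.
by have [] := PU n.
Qed.

Lemma outer_content0 : outer_content set0 = 0.
Proof.
rewrite outer_content_open; last exact: open0.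
apply/eqP; rewrite eq_le inner_content_ge0 andbT.
apply: ge_ereal_sup => _ [C [_ C0] <-].
by move: C0; rewrite subset0 => ->; rewrite content0.
Qed.

HB.instance Definition _ := isOuterMeasure.Build R T outer_content
  outer_content0 outer_content_ge0 outer_content_le
  outer_content_sigma_subadditive.

(** For an open [W] containing the test set, fill [W & U] by a compact [C], then the open set
    [W \ C], which contains the test set minus [U], by a compact [D]. Then [C] and [D] are disjoint
    in [W], so [m D + m C] is at most the inner content of [W]. *)
Lemma open_caratheodory U : open U -> outer_content.-caratheodory U.
Proof.
move=> oU; apply: le_caratheodory_measurable => X.
apply: le_ereal_inf_tmp => _ [W [oW XW] <-]; rewrite -setDE.
have [->|Woo] := eqVneq (inner_content W) +oo; first exact: leey.
have fW : inner_content W \is a fin_num.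
  by rewrite ge0_fin_numE ?inner_content_ge0// ltey.
have fXU : outer_content (X `\` U) \is a fin_num.
  rewrite ge0_fin_numE ?outer_content_ge0//.
  apply: (@le_lt_trans _ _ (inner_content W)); last by rewrite ltey.
  rewrite -outer_content_open//; apply: outer_content_le.
  exact: subset_trans (@subDsetl _ _ _) XW.
apply: (@le_trans _ _ (inner_content (W `&` U) + outer_content (X `\` U))).
  rewrite leeD2r// -outer_content_open; last exact: openI.
  by apply: outer_content_le; exact: setSI.
rewrite -leeBrDr//; apply: ge_ereal_sup => _ [C [cC CWU] <-].
rewrite leeBrDr// addeC -leeBrDr//.
have oWC : open (W `\` C).
  by apply: openI => //; apply: closed_openC; exact: compact_closed.
apply: (@le_trans _ _ (inner_content (W `\` C))).
  rewrite -outer_content_open//; apply: outer_content_le => x [Xx Ux].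
  by split; [exact: XW|move=> /CWU[]].
apply: ge_ereal_sup => _ [D [cD DWC] <-].
rewrite leeBrDr// -EFinD -mU//; last first.
  by apply/disjoints_subset => x /DWC[].
apply: inner_content_ge; first exact: compactU.
by move=> x [/DWC[]|/CWU[]].
Qed.

Lemma borel_caratheodory A : borel A -> outer_content.-caratheodory A.
Proof.
suff : @borel T `<=` outer_content.-caratheodory by apply.
apply: smallest_sub; last exact: open_caratheodory.
split; first exact: caratheodory_measurable_set0.
- by move=> B; rewrite setTD; exact: caratheodory_measurable_setC.
- exact: caratheodory_measurable_bigcup.
Qed.

Lemma radon_outer_content : radon_measure outer_content.
Proof.
split.
- split; [exact: outer_content0|by move=> A _; exact: outer_content_ge0|].
  move=> F bF tF; have mF n := borel_caratheodory (bF n).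
  suff -> : outer_content (\bigcup_n F n) = \sum_(i <oo) outer_content (F i).
    by apply: is_cvg_nneseries => n _ _; exact: outer_content_ge0.
  apply/eqP; rewrite eq_le outer_content_sigma_subadditive /=.
  (* With the union itself as test set, the part outside the union is empty and superadditivity
     remains. *)
  have := caratheodory_lime_le mF tF (\bigcup_n F n).
  rewrite setICr outer_measure0 adde0; congr (_ <= _)%E.
  apply: eq_eseriesr => i _; congr (outer_content _).
  by apply/setIidPr; exact: bigcup_sup.
- move=> C cC.
  (* Local compactness encloses [C] in an open [W] inside a compact [D], so the finite number [m D]
     bounds its outer content. *)
  suff [W [D [CW oW WD cD]]] : exists W D,
      [/\ C `<=` W, open W, W `<=` D & compact D].
    apply: le_lt_trans (outer_content_le CW) _; rewrite outer_content_open//.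
    apply: (@le_lt_trans _ _ (m D)%:E); last exact: ltry.
    apply: ge_ereal_sup => _ [E [cE EW] <-]; rewrite lee_fin m_le//.
    exact: subset_trans WD.
  apply: (@compact_induction _ (fun A => exists W D,
    [/\ A `<=` W, open W, W `<=` D & compact D])) cC.
  + move=> A B AB [W [D [BW ? ? ?]]]; exists W, D; split=> //.
    exact: subset_trans BW.
  + by exists set0, set0; split=> //; [exact: open0|exact: compact0].
  + move=> A B [W [D [AW oW WD cD]]] [W' [D' [BW' oW' WD' cD']]].
    exists (W `|` W'), (D `|` D'); split.
    * exact: setUSS.
    * exact: openU.
    * exact: setUSS.
    * exact: compactU.
  + move=> p _; have [D cD nD] := lcT p; exists D°; first exact: nbhs_interior.
    exists D°, D; split=> //; [exact: open_interior|exact: interior_subset].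
- move=> U oU; apply/eqP; rewrite eq_le; apply/andP; split; last first.
    by apply: ge_ereal_sup => _ [C [_ CU] <-]; exact: outer_content_le.
  rewrite outer_content_open//.
  apply: ge_ereal_sup => _ [C [cC CU] <-].
  apply: (@le_trans _ _ (outer_content C)).
    apply: le_ereal_inf_tmp => _ [W [_ CW] <-]; exact: inner_content_ge.
  by apply: ereal_sup_ubound; exists C.
- move=> B _; congr ereal_inf; apply/seteqP; split=> _ [U [oU BU] <-];
  by exists U => //; rewrite outer_content_open.
Qed.

End ContentExtension.

(** * The Lawson topology on the open filters *)

Section LawsonTopology.
Context {d : Order.disp_t} {K : tLatticeType d}.
Hypotheses (domK : is_domain K) (topK : way_below (\top%O : K) (\top%O : K))
  (mulK : multiplicative_way_below K).
Implicit Types (x y z : K) (V W : OFilt' K) (s : seq K).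

Definition ofilt_of V : OFilt K := set_val V.

Definition mem_ofilt V : set K := ofilt_of V.

Lemma mem_ofilt_inj V W : mem_ofilt V = mem_ofilt W -> V = W.
Proof.
move=> VW; apply: eq_sig_hprop; first by move=> *; exact: eq_irrelevance.
by have : ofilt_of V = ofilt_of W by exact: val_inj.
Qed.

Lemma ofilt_of_surj (W : OFilt K) x : ~ (W : set K) x ->
  exists V, ofilt_of V = W.
Proof.
move=> Wx; have WT : (W : lawson (OFilt K)) \in
    [set V : lawson (OFilt K) | (V : OFilt K) <> setT :> set K].
  by apply/mem_set => WT; apply: Wx; have : [set: K] x by []; rewrite -WT.
by exists (exist _ (W : lawson (OFilt K)) WT).
Qed.

Definition cell s x : set (OFilt' K) :=
  [set V | (forall y, y \in s -> ofilt'_avoid y V) /\ mem_ofilt V x].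

(** [F^z] is closed but need not be open; a [y] outside [V] with [z << y] puts [V] in its interior.
    Nonemptiness of [p.1] keeps the cell inside some [F^z], so that its mass is finite and
    expressible through Phi. *)
Definition cell_at V : set (seq K * K) :=
  [set p | [/\ p.1 != [::],
               forall z, z \in p.1 ->
                 exists2 y, way_below z y & ~ mem_ofilt V y
             & mem_ofilt V p.2]].

Lemma ofilt'_avoid_neq0 V : exists y, ofilt'_avoid y V.
Proof.
have := set_valP V => /= VT; apply/not_existsP => aV; apply: VT.
by apply/seteqP; split=> // x _; apply: contrapT; exact: aV.
Qed.

Lemma way_below_exists x : exists z, way_below z x.
Proof. by have [_ /(_ x)[[[z]]]] := domK; exists z. Qed.

Lemma filter_in_cell (F : set_system (OFilt' K)) s x : Filter F ->
  (forall y, y \in s -> F (ofilt'_avoid y)) -> F [set W | mem_ofilt W x] ->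
  F (cell s x).
Proof.
move=> FF Fs Fx; apply: filterI => //.
elim: s Fs => [|z s IH] Fs; first by apply: filterS filterT.
have Fs' := IH (fun y ys => Fs y (mem_behead (s := z :: s) ys)).
apply: filterS (filterI (Fs z (mem_head _ _)) Fs') => W [Wz Ws] y.
by rewrite inE => /predU1P[->|/Ws].
Qed.

Lemma cell_filter V :
  Filter (filter_from (cell_at V) (fun p => cell p.1 p.2)).
Proof.
apply: filter_from_filter.
  have [y Vy] := ofilt'_avoid_neq0 V; have [z zy] := way_below_exists y.
  exists ([:: z], \top%O); split=> //=; last exact: ofilt_top.
  by move=> w; rewrite inE => /eqP->; exists y.
move=> [s x] [t y] [/= s0 sV Vx] [/= t0 tV Vy].
exists (s ++ t, Order.meet x y).
  split=> /=; [by case: s s0 {sV}| |exact/ofilt_meet].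
  by move=> z; rewrite mem_cat => /orP[/sV|/tV].
move=> W [/= Wst /ofilt_meet[Wx Wy]]; split; split=> // z zs; apply: Wst;
  by rewrite mem_cat zs ?orbT.
Qed.

(** [V] is the directed supremum of the filters [way_above x] with [x] in [V]. So [U] contains one
    of them, and any open filter containing that [x] is larger. *)
Lemma scott_open_cell V (U : set (OFilt K)) : scott_open U ->
  U (ofilt_of V) ->
  exists2 x, mem_ofilt V x & [set W | mem_ofilt W x] `<=` ofilt_of @^-1` U.
Proof.
move=> [uU sU] UV.
pose E := [set way_above domK topK mulK x | x in mem_ofilt V].
have dE : directed E.
  split.
    by exists (way_above domK topK mulK \top%O), \top%O => //; exact: ofilt_top.
  move=> _ _ [a Va <-] [b Vb <-].
  exists (way_above domK topK mulK (Order.meet a b)); split.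
  - by exists (Order.meet a b) => //; exact/ofilt_meet.
  - by apply/OFilt_leE => y; apply: le_way_below_trans; exact: leIl.
  - by apply/OFilt_leE => y; apply: le_way_below_trans; exact: leIr.
have lE : isLub E (ofilt_of V).
  split=> [_ [x Vx <-]|W EW]; apply/OFilt_leE => y.
    by move=> /way_below_le; exact: ofilt_upper.
  move=> /(ofilt_way_below domK)[z Vz zy].
  have /OFilt_leE/(_ y) := EW (way_above domK topK mulK z) (imageP _ Vz).
  exact.
have [_ [[x Vx <-] Ux]] := sU E _ dE lE UV.
exists x => // W Wx; apply: uU Ux _; apply/OFilt_leE => y /way_below_le.
exact: ofilt_upper.
Qed.

Lemma nbhs_mem V x : mem_ofilt V x -> nbhs V [set W | mem_ofilt W x].
Proof.
move=> Vx; apply: open_nbhs_nbhs; split=> //.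
rewrite open_OFilt'E; exists [set W : lawson (OFilt K) | (W : set K) x] => //.
rewrite lawson_openE.
pose B : set (OFilt K) := [set W : OFilt K | (W : set K) x].
exists [set B]; last by rewrite bigcup_set1.
move=> _ ->; apply: (@finI_from1 _ _ _ id); left; split.
  by move=> W W' Wx /OFilt_leE; apply.
move=> E S dE [ES lS] Sx.
apply: contrapT => Ex.
(* Scott openness holds because the union of a directed family of open
   filters is again an open filter. *)
have SE : (S : set K) `<=` \bigcup_(W in E) (W : set K).
  pose L := \bigcup_(W in E) (W : set K).
  have oL : open_filter L.
    split.
    - have [[W EW] _] := dE; exists \top%O, W => //; exact: ofilt_top.
    - move=> a b [W EW Wa] [W' EW' W'b].
      have [W2 [EW2 /OFilt_leE WW2 /OFilt_leE W'W2]] := dE.2 _ _ EW EW'.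
      exists (Order.meet a b); split; rewrite ?leIl ?leIr//; exists W2 => //.
      by apply/ofilt_meet; split; [exact: WW2|exact: W'W2].
    - split=> [a b [W EW Wa] ab|D t dD lD [W EW Wt]].
        by exists W => //; exact: ofilt_upper ab.
      have /asboolP[_ _ [_ /(_ D t dD lD Wt)[w [Dw Ww]]]] := ofilt_setP W.
      by exists w; split=> //; exists W.
  have /OFilt_leE : (S <= MkOFilt (asboolT oL))%O.
    by apply: lS => W EW; apply/OFilt_leE => a Wa; exists W.
  exact.
have [W EW Wx] := SE _ Sx.
by apply: Ex; exists W.
Qed.

(** The complement of the principal upper set of [way_above z] is Lawson open. It contains [V]
    because of [y], and any [W] in it misses [z], as an open filter containing [z] contains
    [way_above z]. *)
Lemma nbhs_avoid V y z : way_below z y -> ~ mem_ofilt V y ->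
  nbhs V (ofilt'_avoid z).
Proof.
move=> zy Vy.
pose B : set (OFilt K) := ~` [set W | (way_above domK topK mulK z <= W)%O].
have BV : B (ofilt_of V) by move=> /OFilt_leE/(_ y zy).
apply: (@filterS _ (nbhs V) _ (set_val @^-1` (B : set (lawson (OFilt K))))).
  move=> W BW Wz; apply: BW; apply/OFilt_leE => w /way_below_le.
  exact: ofilt_upper.
apply: open_nbhs_nbhs; split=> //.
rewrite open_OFilt'E; exists (B : set (lawson (OFilt K))) => //.
rewrite lawson_openE; exists [set B]; last by rewrite bigcup_set1.
by move=> _ ->; apply: (@finI_from1 _ _ _ id); right; eexists.
Qed.

(** Since cells at [V] generate a filter, it suffices to fit one inside each subbasic open set
    around [V]. *)
Lemma nbhs_cellP V U :
  nbhs V U <-> exists2 p, cell_at V p & cell p.1 p.2 `<=` U.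
Proof.
split; last first.
  move=> [[s x] [/= _ sV Vx]] /filterS; apply.
  apply: filter_in_cell; last exact: nbhs_mem.
  by move=> z /sV[y zy Vy]; exact: nbhs_avoid Vy.
rewrite nbhsE => -[_ [[N [D sD <-] <-] [B DB VB]] NU].
have [I sI BE] := sD B DB.
suff : filter_from (cell_at V) (fun p => cell p.1 p.2)
    (ofilt_of @^-1` (\bigcap_(i in [set` I]) i)).
  move=> [p Vp pB]; exists p => // W /pB WB; apply: NU => /=; exists B => //.
  by rewrite -BE.
rewrite preimage_bigcap; have FF := cell_filter V.
apply: filter_bigI => C CI.
have VC : (C : set (OFilt K)) (ofilt_of V) by move: VB; rewrite -BE; apply.
have /set_mem[sC|[x CE]] := sI C CI.
- have [x Vx xC] := scott_open_cell sC VC.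
  (* Only the condition on [x] matters here; the nonempty list [s] is borrowed from any cell at
     [V]. *)
  have [[s y] [/= s0 sV Vy] _] := filterT (F := filter_from (cell_at V) _).
  exists (s, x) => //= W [_ Wx]; exact: xC.
(* Here [x] is an open filter not included in [V]. Take [y] in it outside [V], then [z << y] still
   in it: an open filter missing [z] cannot include [x]. *)
- have [y xy Vy] : exists2 y, (x : set K) y & ~ mem_ofilt V y.
    apply: contrapT => H; move: VC; rewrite CE; apply; apply/OFilt_leE => y xy.
    by apply: contrapT => Vy; apply: H; exists y.
  have [z xz zy] := ofilt_way_below domK xy.
  exists ([:: z], \top%O).
    split=> //=; last exact: ofilt_top.
    by move=> w; rewrite inE => /eqP ->; exists y.
  move=> W [/= /(_ z (mem_head _ _)) Wz _].
  rewrite /preimage CE => /OFilt_leE xW.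
  by apply: Wz; exact: xW.
Qed.

Lemma closed_ofilt'_avoid x : closed (ofilt'_avoid (K := K) x).
Proof.
rewrite -[X in closed X]setCK; apply: open_closedC.
rewrite openE => V /contrapT Vx; have := nbhs_mem Vx.
by apply: filterS => W Wx; apply.
Qed.

(** If [x] is in [V] but not in [W], some [z << x] is in [V]; containing [z] and avoiding [z] are
    then disjoint neighbourhood conditions for [V] and [W]. *)
Lemma hausdorff_OFilt' : hausdorff_space (OFilt' K).
Proof.
have sep V W x : cluster (nbhs V) W -> mem_ofilt V x -> mem_ofilt W x.
  move=> VW Vx; apply: contrapT => Wx.
  have [z Vz zx] := ofilt_way_below domK Vx.
  by have [V' [V'z]] := VW _ _ (nbhs_mem Vz) (nbhs_avoid zx Wx).
move=> V W VW; apply: mem_ofilt_inj.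
have WV : cluster (nbhs W) V by move=> A B WA VB; rewrite setIC; exact: VW.
by apply/seteqP; split=> x; exact: sep.
Qed.

(** Along an ultrafilter, the elements belonging to almost every open filter form a filter [L] that
    need not be Scott open; its interior [V0] is the limit. *)
Lemma compact_ofilt'_avoid x : compact (ofilt'_avoid (K := K) x).
Proof.
rewrite compact_ultra => F UF Fx.
pose L := [set z | F [set W | mem_ofilt W z]].
have L1 : L \top%O by apply: filterS filterT => W _; exact: ofilt_top.
have LI a b : L a -> L b -> L (Order.meet a b).
  move=> La Lb; apply: filterS (filterI La Lb) => W.
  by rewrite -[_ W]/(_ /\ _) => /ofilt_meet.
pose V0 := ofilt_interior domK topK mulK L1 LI.
have Lup a b : L a -> (a <= b)%O -> L b.
  by move=> La ab; apply: filterS La => W Wa; exact: ofilt_upper ab.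
have V0L y : (V0 : set K) y -> L y by move=> [z Lz /way_below_le]; exact: Lup.
have V0x : ~ (V0 : set K) x.
  by move=> /V0L Lx; have [W []] := filter_ex (filterI Fx Lx).
(* Missing [x] is what keeps the limit different from the whole of [K]. *)
have [V1 V1E] := ofilt_of_surj V0x.
exists V1; split=> [|U /nbhs_cellP[[s y] [/= _ sV Vy]] /filterS]; last apply.
  by rewrite /ofilt'_avoid /= /ofilt_avoid /= -[set_val V1]/(ofilt_of V1) V1E.
rewrite /mem_ofilt V1E in sV Vy.
apply: filter_in_cell => [z /sV[w zw V0w]|]; last exact: V0L.
(* Otherwise almost every filter contains [z], so [z] is in [L] and [z << w] forces [w] into
   [V0]. *)
have [//|Lz] := in_ultra_setVsetC (ofilt'_avoid z) UF.
exfalso; apply: V0w; exists z => //; apply: filterS Lz => W /contrapT; exact.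
Qed.

Lemma locally_compact_OFilt' V :
  exists2 C : set (OFilt' K), compact C & nbhs V C.
Proof.
have [y Vy] := ofilt'_avoid_neq0 V; have [z zy] := way_below_exists y.
exists (ofilt'_avoid z); [exact: compact_ofilt'_avoid|exact: nbhs_avoid zy Vy].
Qed.

Lemma ofilt'_avoidI x y :
  ofilt'_avoid (K := K) (Order.meet x y) = ofilt'_avoid x `|` ofilt'_avoid y.
Proof.
apply/seteqP; split=> V /=.
  move=> Vxy; have [Vx|] := pselect (mem_ofilt V x); last by left.
  by right=> Vy; apply: Vxy; exact/ofilt_meet.
by move=> VxVy /ofilt_meet[Vx Vy]; case: VxVy; apply.
Qed.

Lemma le_ofilt'_avoid x y : (x <= y)%O ->
  ofilt'_avoid (K := K) y `<=` ofilt'_avoid x.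
Proof. by move=> xy V Vy Vx; apply: Vy; exact: ofilt_upper xy. Qed.

Lemma ofilt'_avoid_sub_interior x z : way_below z x ->
  ofilt'_avoid x `<=` (ofilt'_avoid (K := K) z)°.
Proof. by move=> zx V Vx; exact: nbhs_avoid Vx. Qed.

End LawsonTopology.

(** * Measures of cells and uniqueness *)

Section BorelMeasures.
Context {R : realType} {T : topologicalType}.
Implicit Types (A B : set T) (mu : set T -> \bar R).

Lemma borel_open A : open A -> borel A.
Proof. exact: (@sub_sigma_algebra _ setT (@open T)). Qed.

Lemma borelC A : borel A -> borel (~` A).
Proof. by rewrite -setTD; exact: sigma_algebraCD. Qed.

Lemma borel_closed A : closed A -> borel A.
Proof. by move=> /closed_openC/borel_open/borelC; rewrite setCK. Qed.

Lemma borelU A B : borel A -> borel B -> borel (A `|` B).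
Proof.
move=> bA bB; rewrite -bigcup2E; apply: sigma_algebra_bigcup => -[|[|n]] //=.
exact: sigma_algebra0.
Qed.

Lemma borelI A B : borel A -> borel B -> borel (A `&` B).
Proof.
move=> bA bB; rewrite -(setCK (A `&` B)) setCI.
by apply: borelC; apply: borelU; exact: borelC.
Qed.

Lemma borelD A B : borel A -> borel B -> borel (A `\` B).
Proof. by move=> bA bB; apply: borelI => //; exact: borelC. Qed.

Local Open Scope ereal_scope.

Variable mu : set T -> \bar R.
Hypothesis bmu : borel_measure mu.

Lemma borel_measureU A B : borel A -> borel B -> A `&` B = set0 ->
  mu (A `|` B) = mu A + mu B.
Proof.
move=> bA bB AB; have [mu0 _ muS] := bmu.
have bF n : borel (bigcup2 A B n).
  by case: n => [|[|n]] //=; exact: sigma_algebra0.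
have tF : trivIset setT (bigcup2 A B) by rewrite -trivIset_bigcup2.
have := muS _ bF tF; rewrite bigcup2E => /cvg_lim <- //.
(* The partial sums are constant from index 2 on. *)
apply/cvg_lim => //; rewrite -(cvg_shiftn 2)/=; apply: cvg_near_cst.
apply: nearW => k; rewrite big_mkord addn2 2!big_ord_recl big1 ?adde0//.
Qed.

Lemma borel_measure_split A B : borel A -> borel B -> A `<=` B ->
  mu B = mu A + mu (B `\` A).
Proof.
move=> bA bB AB; rewrite -borel_measureU ?setDUK//; first exact: borelD.
by rewrite setDIK.
Qed.

Lemma le_borel_measure A B : borel A -> borel B -> A `<=` B -> mu A <= mu B.
Proof.
move=> bA bB AB; rewrite (borel_measure_split bA bB AB) leeDl//.
by have [_ mu_ge0 _] := bmu; apply: mu_ge0; exact: borelD.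
Qed.

Lemma borel_measureD A B (a b : R) : borel A -> borel B -> A `<=` B ->
  mu A = a%:E -> mu B = b%:E -> mu (B `\` A) = (b - a)%:E.
Proof.
move=> bA bB AB Aa; rewrite (borel_measure_split bA bB AB) Aa EFinB => <-.
by rewrite addeAC subee// add0e.
Qed.

End BorelMeasures.
Arguments borel_open {T A}.

Section Cells.
Context {R : realType} {d : Order.disp_t} {K : tLatticeType d}.
Hypotheses (domK : is_domain K) (topK : way_below (\top%O : K) (\top%O : K))
  (mulK : multiplicative_way_below K).
Implicit Types (x y z : K) (s t : seq K).

(** This is the recursion of [nabla] at the level of sets: the measure of [cell (z :: s)] is [nabla]
    by [z] of that of [cell s]. *)
Lemma cell_cons z s x :
  cell (z :: s) x = cell s x `\` cell s (Order.meet x z).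
Proof.
apply/seteqP; split=> V.
  move=> [Vzs Vx]; split.
    by split=> // y ys; apply: Vzs; rewrite inE ys orbT.
  by move=> [_ /ofilt_meet[_ Vz]]; exact: (Vzs z (mem_head _ _)).
move=> [[Vs Vx] Vsxz]; split=> // y; rewrite inE => /predU1P[->|/Vs//].
by move=> Vz; apply: Vsxz; split=> //; exact/ofilt_meet.
Qed.

(** The recursion starts here and not at the empty list, whose cell may have infinite measure. The
    minus sign in [measure_cell] enters here. *)
Lemma cell1 z x :
  cell [:: z] x = ofilt'_avoid (Order.meet x z) `\` ofilt'_avoid x.
Proof.
rewrite ofilt'_avoidI setDUl setDv set0U; apply/seteqP; split=> V.
  by move=> [Vz Vx]; split; [exact: Vz (mem_head _ _)|apply].
by move=> [Vz /contrapT Vx]; split=> // y; rewrite inE => /eqP ->.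
Qed.

Lemma cellI s x t y : cell s x `&` cell t y = cell (s ++ t) (Order.meet x y).
Proof.
apply/seteqP; split=> V.
  move=> [[Vs Vx] [Vt Vy]]; split; last exact/ofilt_meet.
  by move=> z; rewrite mem_cat => /orP[/Vs|/Vt].
move=> [Vst /ofilt_meet[Vx Vy]]; split; split=> // z zs; apply: Vst;
  by rewrite mem_cat zs ?orbT.
Qed.

Lemma borel_avoid x : borel (ofilt'_avoid (K := K) x).
Proof. by apply: borel_closed; exact: closed_ofilt'_avoid. Qed.

Lemma borel_cell s x : s != [::] -> borel (cell s x).
Proof.
elim: s x => [//|z [|y s] IH] x _; last first.
  by rewrite cell_cons; apply: borelD; exact: IH.
by rewrite cell1; apply: borelD; exact: borel_avoid.
Qed.

Section CellMeasure.
Variables (Phi : K -> R) (mu : set (OFilt' K) -> \bar R).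
Hypotheses (bmu : borel_measure mu)
  (muE : forall x, (Phi x)%:E = mu (ofilt'_avoid x)).

Lemma measure_cell s x : s != [::] -> mu (cell s x) = (- nablas Phi s x)%:E.
Proof.
elim: s x => [//|z s IH] x _.
have [->|s0] := eqVneq s [::].
  rewrite cell1 (borel_measureD bmu (a := Phi x) (b := Phi (Order.meet x z)))//.
  - by rewrite /= /nabla opprB.
  - exact: borel_avoid.
  - exact: borel_avoid.
  - by apply: le_ofilt'_avoid; exact: leIl.
rewrite cell_cons /= nablas_nabla /nabla.
rewrite (borel_measureD bmu (a := - nablas Phi s (Order.meet x z))
  (b := - nablas Phi s x)) ?IH//; first by rewrite opprB opprK addrC.
- exact: borel_cell.
- exact: borel_cell.
- by move=> V [Vs /ofilt_meet[]].
Qed.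

Lemma completely_alternating_measure : completely_alternating Phi.
Proof.
split=> [x y xy|S S0 x].
  rewrite -lee_fin !muE; apply: (le_borel_measure bmu);
    [exact: borel_avoid|exact: borel_avoid|exact: le_ofilt'_avoid].
have s0 : enum_fset S != [::].
  apply: contra_neq S0 => SE; apply/fsetP => y.
  by rewrite -[LHS]/(y \in enum_fset S) SE.
rewrite -oppr_ge0 -lee_fin -measure_cell//; have [_ mu_ge0 _] := bmu.
by apply: mu_ge0; exact: borel_cell.
Qed.

End CellMeasure.

(* As z increases to x, the compact sets [ofilt'_avoid z] decrease to
   [ofilt'_avoid x]. *)
Lemma ofilt'_avoid_sub_open x (U : set (OFilt' K)) : open U ->
  ofilt'_avoid x `<=` U ->
  exists2 z, way_below z x & ofilt'_avoid z `<=` U.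
Proof.
move=> oU xU; have [_ /(_ x)[[_ dx] _ _]] := domK.
have [z0 z0x] := way_below_exists domK x.
have cC : compact (ofilt'_avoid z0 `\` U).
  apply: (@subclosed_compact _ _ (ofilt'_avoid z0)).
  - by apply: closedI; [exact: closed_ofilt'_avoid|exact: open_closedC].
  - exact: compact_ofilt'_avoid.
  - exact: subDsetl.
have [z zx zU] : exists2 z, way_below z x &
    ofilt'_avoid z0 `\` U `<=` [set W | mem_ofilt W z].
  apply: (@compact_induction _ (fun A => exists2 z, way_below z x &
    A `<=` [set W | mem_ofilt W z])) cC.
  - by move=> A B AB [z zx Bz]; exists z => //; exact: subset_trans Bz.
  - by exists z0.
  - move=> A B [a ax Aa] [b bx Bb]; have [c [cx ac bc]] := dx a b ax bx.
    exists c => // V [/Aa Va|/Bb Vb];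
      by [exact: ofilt_upper ac|exact: ofilt_upper bc].
  - move=> V [_ VU]; have Vx : mem_ofilt V x by apply: contrapT => /xU.
    have [z Vz zx] := ofilt_way_below domK Vx.
    by exists [set W | mem_ofilt W z]; [exact: nbhs_mem|exists z].
have [c [cx z0c zc]] := dx z0 z z0x zx.
exists c => // V Vc; apply: contrapT => VU.
have Vz : mem_ofilt V z.
  by apply: zU; split=> // Vz0; apply: Vc; exact: ofilt_upper z0c.
by apply: Vc; exact: ofilt_upper zc.
Qed.

(** Monotonicity gives one inequality. For the other, outer regularity yields an open superset of
    [F^x] of nearly the same mass, and it already contains some [F^z] with [z << x]. *)
Lemma conjugate_scott_measure (Phi : K -> R) (mu : set (OFilt' K) -> \bar R) :
  (forall x, 0 <= Phi x) -> Phi \top%O = 0 -> radon_measure mu ->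
  (forall x, (Phi x)%:E = mu (ofilt'_avoid x)) -> conjugate_scott Phi.
Proof.
move=> Phi_ge0 Phi_top rmu muE; split=> // x.
have [bmu _ _ outer] := rmu.
have lb0 : has_lbound [set Phi z | z in [set z | way_below z x]].
  by exists 0 => _ [z _ <-].
apply/eqP; rewrite eq_le; apply/andP; split.
  apply: lb_le_inf.
    by have [z zx] := way_below_exists domK x; exists (Phi z), z.
  move=> _ [z /way_below_le zx <-].
  by have [mono _] := completely_alternating_measure bmu muE; exact: mono.
apply/ler_addgt0Pr => e e0.
have : (mu (ofilt'_avoid x) < (Phi x + e)%:E)%E by rewrite -muE lte_fin ltrDl.
rewrite outer; last exact: borel_avoid.
move=> /ereal_inf_lt[_ [U [oU xU] <-] Ue].
have [z zx zU] := ofilt'_avoid_sub_open oU xU.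
apply: (@le_trans _ _ (Phi z)); first by apply: ge_inf => //; exists z.
rewrite -lee_fin muE; apply: ltW; apply: le_lt_trans Ue.
by apply: (le_borel_measure bmu) => //; [exact: borel_avoid|exact: borel_open].
Qed.

Definition cells (l : seq (seq K * K)) : set (OFilt' K) :=
  [set V | exists2 p, p \in l & cell p.1 p.2 V].

Definition proper_cells (l : seq (seq K * K)) :=
  forall p, p \in l -> p.1 != [::].

Lemma cells_cons p l : cells (p :: l) = cell p.1 p.2 `|` cells l.
Proof.
apply/seteqP; split=> V.
  by move=> [q]; rewrite inE => /predU1P[->|ql] Vq; [left|right; exists q].
move=> [Vp|[q ql Vq]]; first by exists p => //; exact: mem_head.
by exists q => //; rewrite inE ql orbT.
Qed.

Lemma cellsI p l : cells l `&` cell p.1 p.2 =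
  cells [seq (q.1 ++ p.1, Order.meet q.2 p.2) | q <- l].
Proof.
apply/seteqP; split=> V.
  move=> [[q ql Vq] Vp]; exists (q.1 ++ p.1, Order.meet q.2 p.2).
    by apply/mapP; exists q.
  by rewrite -cellI.
move=> [_ /mapP[q ql ->]] /=; rewrite -cellI => -[Vq Vp].
by split=> //; exists q.
Qed.

Lemma borel_cells l : proper_cells l -> borel (cells l).
Proof.
elim: l => [|p l IH] pl.
  rewrite (_ : cells _ = set0); first exact: sigma_algebra0.
  by apply/seteqP; split=> V [].
rewrite cells_cons; apply: borelU.
  by apply: borel_cell; exact: pl (mem_head _ _).
by apply: IH => q ql; apply: pl; rewrite inE ql orbT.
Qed.

Lemma cells_between (C U : set (OFilt' K)) : compact C -> open U -> C `<=` U ->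
  exists l, [/\ proper_cells l, C `<=` cells l & cells l `<=` U].
Proof.
move=> cC oU CU.
apply: (@compact_induction _ (fun A => exists l,
  [/\ proper_cells l, A `<=` cells l & cells l `<=` U])) cC.
- by move=> A B AB [l [? Bl ?]]; exists l; split=> //; exact: subset_trans Bl.
- by exists [::]; split=> // V [].
- move=> A B [l [pl Al lU]] [k [pk Bk kU]]; exists (l ++ k); split.
  + by move=> p; rewrite mem_cat => /orP[/pl|/pk].
  + by move=> V [/Al|/Bk] [p pl' Vp]; exists p; rewrite // mem_cat pl' ?orbT.
  + move=> V [p]; rewrite mem_cat => /orP[pl'|pk'] Vp.
      by apply: lU; exists p.
    by apply: kU; exists p.
- move=> V /CU UV.
  have /(nbhs_cellP domK topK mulK)[p Vp pU] := open_nbhs_nbhs (conj oU UV).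
  exists (cell p.1 p.2).
    by apply/(nbhs_cellP domK topK mulK); exists p.
  exists [:: p]; split=> [q|W Wp|W [q]]; rewrite ?inE.
  + by move=> /eqP ->; have [] := Vp.
  + by exists p; rewrite ?inE.
  + by move=> /eqP -> /pU.
Qed.

Section Uniqueness.
Variables (Phi : K -> R) (mu nu : set (OFilt' K) -> \bar R).
Hypotheses (rmu : radon_measure mu) (rnu : radon_measure nu)
  (muE : forall x, (Phi x)%:E = mu (ofilt'_avoid x))
  (nuE : forall x, (Phi x)%:E = nu (ofilt'_avoid x)).

(** Inclusion-exclusion: intersecting [cells l] with one more cell gives a union [cells k] of
    equally many cells, so both measures of the union follow from the same values of Phi. *)
Lemma measure_cells l : proper_cells l ->
  exists r : R, mu (cells l) = r%:E /\ nu (cells l) = r%:E.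
Proof.
have [[bmu _ _ _] [bnu _ _ _]] := (rmu, rnu).
(* Induction on the length, because [k] is as long as [l] but is not a part of it. *)
have [n sl] := ubnP (size l); elim: n l sl => [//|n IH] [|p l] /=.
  have -> : cells [::] = set0 by apply/seteqP; split=> V [].
  by exists 0; split; [have [] := bmu|have [] := bnu].
rewrite ltnS => ln pl; have p0 := pl p (mem_head _ _).
have pl' : proper_cells l by move=> q ql; apply: pl; rewrite inE ql orbT.
have [a [mua nua]] := IH l ln pl'.
set k := [seq (q.1 ++ p.1, Order.meet q.2 p.2) | q <- l].
have pk : proper_cells k.
  by move=> _ /mapP[q ql ->] /=; have := pl' q ql; case: (q.1).
have [b [mub nub]] : exists r : R, mu (cells k) = r%:E /\ nu (cells k) = r%:E.
  by apply: IH => //; rewrite size_map.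
have bp : borel (cell p.1 p.2) by exact: borel_cell.
have bl := borel_cells pl'; have bk := borel_cells pk.
have kl : cells k `<=` cells l by rewrite -cellsI; exact: subIsetl.
have lpE : cells l `\` cell p.1 p.2 = cells l `\` cells k.
  by rewrite -cellsI setDIr setDv set0U.
have lE : cells (p :: l) = cell p.1 p.2 `|` (cells l `\` cell p.1 p.2).
  by rewrite cells_cons setDE setUIr setUCr setIT.
have plD : cell p.1 p.2 `&` (cells l `\` cell p.1 p.2) = set0 by rewrite setDIK.
exists (- nablas Phi p.1 p.2 + (a - b)); rewrite lE.
rewrite (borel_measureU bmu bp (borelD bl bp) plD).
rewrite (borel_measureU bnu bp (borelD bl bp) plD).
rewrite lpE (borel_measureD bmu bk bl kl mub mua).
rewrite (borel_measureD bnu bk bl kl nub nua).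
by rewrite (measure_cell bmu muE)// (measure_cell bnu nuE)// EFinD.
Qed.

Lemma le_radon_open U : open U -> (mu U <= nu U)%E.
Proof.
move=> oU; have [[_ _ inner _] [bnu _ _ _]] := (rmu, rnu).
have [bmu _ _ _] := rmu.
rewrite inner//; apply: ge_ereal_sup => _ [C [cC CU] <-].
have [l [pl Cl lU]] := cells_between cC oU CU.
have [r [mur nur]] := measure_cells pl.
apply: (@le_trans _ _ (mu (cells l))).
  apply: (le_borel_measure bmu) => //; last exact: borel_cells.
  by apply: borel_closed; apply: compact_closed => //; exact: hausdorff_OFilt'.
rewrite mur -nur; apply: (le_borel_measure bnu) => //; first exact: borel_cells.
exact: borel_open.
Qed.

End Uniqueness.

Lemma radon_unique (Phi : K -> R) (mu nu : set (OFilt' K) -> \bar R) :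
  radon_measure mu -> radon_measure nu ->
  (forall x, (Phi x)%:E = mu (ofilt'_avoid x)) ->
  (forall x, (Phi x)%:E = nu (ofilt'_avoid x)) ->
  forall B, borel B -> mu B = nu B.
Proof.
move=> rmu rnu muE nuE B bB.
have [[_ _ _ omu] [_ _ _ onu]] := (rmu, rnu).
rewrite omu// onu//; congr ereal_inf.
have E U : open U -> mu U = nu U.
  move=> oU; apply/eqP; rewrite eq_le (le_radon_open rmu rnu muE nuE)//.
  by rewrite (le_radon_open rnu rmu nuE muE).
by apply/seteqP; split=> _ [U [oU BU] <-]; exists U; rewrite ?E.
Qed.

End Cells.

(** * Existence *)

Section FiniteMoebius.
Context {R : realType} {d : Order.disp_t} {K : tLatticeType d}.
Implicit Types (Psi : K -> R) (x y z a : K) (s t : seq K) (E : set K).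

(* Expanding [Psi y = nabla Psi z y + Psi (y `&` z)] along s writes
   [- Psi y] as a sum of [- nabla_S Psi] at the meets of y with s \ S, for S
   ranging over the parts of s; each term is a point mass at that meet. *)
Fixpoint moebius Psi s y E : R :=
  if s is z :: s' then
    moebius (nabla Psi z) s' y E + moebius Psi s' (Order.meet y z) E
  else if `[< E y >] then - Psi y else 0.

(* The same without the term S = set0, the only one of unknown sign. *)
Fixpoint moebius1 Psi s y E : R :=
  if s is z :: s' then
    moebius (nabla Psi z) s' y E + moebius1 Psi s' (Order.meet y z) E
  else 0.

Lemma moebius_eq0 Psi s y E : (forall a, (a <= y)%O -> ~ E a) ->
  moebius Psi s y E = 0.
Proof.
elim: s Psi y => [|z s IH] Psi y Ey /=; first by rewrite asboolF//; exact: Ey.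
rewrite !IH ?addr0// => a ayz; apply: Ey; apply: le_trans ayz _; exact: leIl.
Qed.

Lemma moebius1_eq0 Psi s y E : (forall a, (a <= y)%O -> ~ E a) ->
  moebius1 Psi s y E = 0.
Proof.
elim: s y => [//|z s IH] y Ey /=.
rewrite moebius_eq0// IH ?addr0// => a ayz; apply: Ey.
by apply: le_trans ayz _; exact: leIl.
Qed.

Lemma moebiusU Psi s y E F : E `&` F = set0 ->
  moebius Psi s y (E `|` F) = moebius Psi s y E + moebius Psi s y F.
Proof.
move=> EF; elim: s Psi y => [|z s IH] Psi y /=; last by rewrite !IH addrACA.
have EFy : ~ (E y /\ F y) by move=> ?; rewrite -[False]/(set0 y) -EF.
case: asboolP => [[Ey|Fy]|EFny].
- by rewrite asboolT// asboolF ?addr0// => Fy; exact: EFy.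
- by rewrite asboolF ?asboolT ?add0r// => Ey; exact: EFy.
- by rewrite !asboolF ?addr0// => ?; apply: EFny; [right|left].
Qed.

Lemma moebius1U Psi s y E F : E `&` F = set0 ->
  moebius1 Psi s y (E `|` F) = moebius1 Psi s y E + moebius1 Psi s y F.
Proof.
move=> EF; elim: s y => [|z s IH] y /=; first by rewrite addr0.
by rewrite moebiusU// IH addrACA.
Qed.

Lemma opp_nabla_split Psi z y :
  - nabla Psi z y - Psi (Order.meet y z) = - Psi y.
Proof. by rewrite /nabla opprB addrAC subrr add0r. Qed.

(** A function of the form [nabla _ x] vanishes at every [a <= x], so discarding the point masses
    there leaves the total unchanged. *)
Lemma moebius_nabla Psi x s y :
  moebius (nabla Psi x) s y [set a | ~ (a <= x)%O] = - nabla Psi x y.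
Proof.
elim: s Psi y => [|z s IH] Psi y /=.
  case: asboolP => [//|/contrapT yx].
  by rewrite /nabla (meet_idPl yx) subrr oppr0.
by rewrite nablaC !IH nablaC opp_nabla_split.
Qed.

(** Terms differenced by [x] are covered by [moebius_nabla]; in all others [x] enters the meet, so
    their masses sit below [x] and are not counted. *)
Lemma moebius_in Psi x s y : x \in s ->
  moebius Psi s y [set a | ~ (a <= x)%O] = - nabla Psi x y.
Proof.
elim: s Psi y => [//|z s IH] Psi y; rewrite inE => /predU1P[<-|xs] /=.
  rewrite moebius_nabla moebius_eq0 ?addr0// => a ayx /=; apply.
  by apply: le_trans ayx _; exact: leIr.
by rewrite !IH// nablaC opp_nabla_split.
Qed.

(** The omitted term sits at the meet of [y] with all of [s], hence below [x], so it would not be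
    counted anyway. *)
Lemma moebius1_in Psi x s y : x \in s ->
  moebius1 Psi s y [set a | ~ (a <= x)%O] = - nabla Psi x y.
Proof.
elim: s Psi y => [//|z s IH] Psi y; rewrite inE => /predU1P[<-|xs] /=.
  rewrite moebius_nabla moebius1_eq0 ?addr0// => a ayx /=; apply.
  by apply: le_trans ayx _; exact: leIr.
by rewrite IH// moebius_in// nablaC opp_nabla_split.
Qed.

Variable Phi : K -> R.
Hypothesis altPhi : completely_alternating Phi.

Lemma nablas_le0 t x : t != [::] -> nablas Phi t x <= 0.
Proof.
move=> t0; have [_ /(_ [fset y in t]%fset)] := altPhi.
rewrite /nabla_fset (@nablas_eq_mem _ _ _ _ _ t); last first.
  by move=> y; rewrite -[LHS]/(y \in [fset y in t]%fset) !inE.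
apply; apply: contra_neq t0 => t0; case: t t0 => [//|y t] /fsetP/(_ y).
by rewrite !inE eqxx.
Qed.

(** [t] records the elements already differenced; being nonempty, it gives every weight the sign
    prescribed by complete alternation. *)
Lemma moebius_ge0 t s y E : t != [::] -> 0 <= moebius (nablas Phi t) s y E.
Proof.
elim: s t y => [|z s IH] t y t0 /=.
  by case: ifP => // _; rewrite oppr_ge0 nablas_le0.
by rewrite -nablas_nabla addr_ge0// ?IH// (IH (z :: t)).
Qed.

Lemma moebius1_ge0 s y E : 0 <= moebius1 Phi s y E.
Proof.
elim: s y => [//|z s IH] y /=.
by rewrite addr_ge0// (moebius_ge0 (t := [:: z])).
Qed.

Lemma moebius1_le s y E F : E `<=` F ->
  moebius1 Phi s y E <= moebius1 Phi s y F.
Proof.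
move=> EF; rewrite -(setDUK EF) moebius1U ?setDIK//.
by rewrite lerDl moebius1_ge0.
Qed.

End FiniteMoebius.

Section Existence.
Context {R : realType} {d : Order.disp_t} {K : tLatticeType d}.
Hypotheses (domK : is_domain K) (topK : way_below (\top%O : K) (\top%O : K))
  (mulK : multiplicative_way_below K).
Variable Phi : K -> R.
Hypotheses (scottPhi : conjugate_scott Phi)
  (altPhi : completely_alternating Phi).
Implicit Types (x y z a : K) (s t : seq K) (S : set (OFilt' K)).

(** The preimage under the map sending [a] to [way_above a]. An existential is used because this
    filter can be all of [K] and so fall outside [OFilt' K]. *)
Definition way_above_preimage S : set K :=
  [set a | exists2 V, S V & mem_ofilt V = [set x | way_below a x]].

Let Pre := way_above_preimage.

Lemma way_above_preimageU S S' : Pre (S `|` S') = Pre S `|` Pre S'.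
Proof.
apply/seteqP; split=> a.
  by move=> [V [SV|SV] Va]; [left|right]; exists V.
by move=> [[V SV Va]|[V SV Va]]; exists V => //; [left|right].
Qed.

Lemma way_above_preimageI0 S S' : S `&` S' = set0 -> Pre S `&` Pre S' = set0.
Proof.
move=> SS; apply/seteqP; split=> a // [[V SV Va] [W S'W Wa]].
have VW : V = W by apply: mem_ofilt_inj; rewrite Va Wa.
suff : (S `&` S') V by rewrite SS.
by split=> //; rewrite VW.
Qed.

Lemma way_above_preimageS S S' : S `<=` S' -> Pre S `<=` Pre S'.
Proof. by move=> SS a [V /SS SV Va]; exists V. Qed.

Lemma way_above_preimage_avoid x :
  Pre (ofilt'_avoid x) = [set a | ~ way_below a x].
Proof.
apply/seteqP; split=> a.
  by move=> [V Vx Va] /= ax; apply: Vx; rewrite -[_ x]/(mem_ofilt V x) Va.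
move=> /= ax; pose V := way_above domK topK mulK a.
have Vx : ~ (V : set K) x by [].
have [V' V'E] := ofilt_of_surj Vx; exists V'; last by rewrite /mem_ofilt V'E.
by move=> V'x; apply: Vx; rewrite -V'E.
Qed.

(** The expansion starts at the top because Phi vanishes there, which turns [- nabla Phi x] into
    [Phi x]. *)
Definition finite_mass S s : R := moebius1 Phi s \top%O (Pre S).

Lemma finite_mass_ge0 S s : 0 <= finite_mass S s.
Proof. exact: moebius1_ge0. Qed.

Lemma finite_mass_avoid_ge x s : x \in s ->
  Phi x <= finite_mass (ofilt'_avoid x) s.
Proof.
move=> xs; rewrite /finite_mass way_above_preimage_avoid.
apply: (@le_trans _ _ (moebius1 Phi s \top%O [set a | ~ (a <= x)%O])).
  rewrite moebius1_in// /nabla meet1x opprB.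
  by have [_ _ ->] := scottPhi; rewrite subr0.
by apply: moebius1_le => // a ax /way_below_le.
Qed.

(** If [a <= z] then [a << x]; so the point masses landing in [F^x] sit at points not below [z],
    whose total mass is [Phi z]. *)
Lemma finite_mass_avoid_le S x z s : S `<=` ofilt'_avoid x -> way_below z x ->
  z \in s -> finite_mass S s <= Phi z.
Proof.
move=> Sx zx zs.
apply: (@le_trans _ _ (moebius1 Phi s \top%O [set a | ~ (a <= z)%O])).
  apply: moebius1_le => //; apply: subset_trans (way_above_preimageS Sx) _.
  rewrite way_above_preimage_avoid => a ax az; apply: ax.
  exact: le_way_below_trans zx.
rewrite moebius1_in// /nabla meet1x opprB.
by have [_ _ ->] := scottPhi; rewrite subr0.
Qed.

Lemma finite_mass_ultrafilter : exists U : set_system (seq K),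
  UltraFilter U /\ forall x, U [set s | x \in s].
Proof.
pose F := filter_from [set: seq K] (fun t => [set s : seq K | {subset t <= s}]).
have FF : ProperFilter F.
  apply: filter_from_proper => [|t _]; last by exists t => x.
  apply: filter_from_filter; first by exists [::].
  move=> s t _ _; exists (s ++ t) => // r str; split=> x xs; apply: str;
    by rewrite mem_cat xs ?orbT.
have [U [UU FU]] := ultraFilterLemma FF.
exists U; split=> // x; apply: FU; exists [:: x] => // s xs.
exact: xs (mem_head _ _).
Qed.

(** By compactness of the segment there is a cluster point, and an ultrafilter converges to its
    cluster points. *)
Lemma ultra_bounded_cvg (U : set_system (seq K)) (f : seq K -> R) (r : R) :
  UltraFilter U -> U [set s | f s \in `[0, r]] -> cvg (f @ U).
Proof.
move=> UU Uf; have [l [_ fl]] := @segment_compact R 0 r (f @ U) _ Uf.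
apply/cvg_ex; exists l => N lN.
have [//|UN] := in_ultra_setVsetC (f @^-1` N) UU.
by have [? []] := fl (~` N) N UN lN.
Qed.

Section Limit.
Variable U : set_system (seq K).
Hypotheses (UU : UltraFilter U) (Ux : forall x, U [set s | x \in s]).

(** A genuine limit when [S] lies in some [F^x], where [Phi z] with [z << x] bounds the masses;
    without convergence [lim] returns a default value. *)
Definition limit_mass S : R := lim (finite_mass S @ U).

Lemma cvg_finite_mass S x : S `<=` ofilt'_avoid x -> cvg (finite_mass S @ U).
Proof.
move=> Sx; have [z zx] := way_below_exists domK x.
apply: (@ultra_bounded_cvg _ _ (Phi z)); apply: filterS (Ux z) => s zs.
by rewrite /= in_itv/= finite_mass_ge0 (finite_mass_avoid_le Sx zx zs).
Qed.

Lemma limit_mass_ge0 S x : S `<=` ofilt'_avoid x -> 0 <= limit_mass S.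
Proof.
move=> /cvg_finite_mass cS; apply: limr_ge => //.
by apply: filterS filterT => s _; exact: finite_mass_ge0.
Qed.

Lemma limit_massU S S' x : S `<=` ofilt'_avoid x -> S' `<=` ofilt'_avoid x ->
  S `&` S' = set0 -> limit_mass (S `|` S') = limit_mass S + limit_mass S'.
Proof.
move=> Sx S'x SS; rewrite /limit_mass.
rewrite -limD; [|exact: cvg_finite_mass Sx|exact: cvg_finite_mass S'x].
congr (lim (_ @ U)); apply/funext => s.
rewrite /finite_mass way_above_preimageU moebius1U//.
exact: way_above_preimageI0.
Qed.

Lemma limit_mass_le S S' x : S' `<=` ofilt'_avoid x -> S `<=` S' ->
  limit_mass S <= limit_mass S'.
Proof.
move=> S'x SS; have Sx := subset_trans SS S'x.
have Dx : S' `\` S `<=` ofilt'_avoid x by move=> V [/S'x].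
by rewrite -(setDUK SS) (limit_massU Sx Dx) ?setDIK// lerDl (limit_mass_ge0 Dx).
Qed.

Lemma limit_massU_le S S' x : S `<=` ofilt'_avoid x -> S' `<=` ofilt'_avoid x ->
  limit_mass (S `|` S') <= limit_mass S + limit_mass S'.
Proof.
move=> Sx S'x; have Dx : S' `\` S `<=` ofilt'_avoid x by move=> V [/S'x].
have -> : S `|` S' = S `|` (S' `\` S) by rewrite setDE setUIr setUCr setIT.
rewrite (limit_massU Sx Dx) ?setDIK// lerD2l; apply: limit_mass_le S'x _.
exact: subDsetl.
Qed.

Lemma limit_mass_avoid_ge x : Phi x <= limit_mass (ofilt'_avoid x).
Proof.
apply: limr_ge; first exact: (@cvg_finite_mass _ x).
by apply: filterS (Ux x) => s; exact: finite_mass_avoid_ge.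
Qed.

Lemma limit_mass_le_avoid S x z : S `<=` ofilt'_avoid x -> way_below z x ->
  limit_mass S <= Phi z.
Proof.
move=> Sx zx; apply: limr_le; first exact: cvg_finite_mass Sx.
by apply: filterS (Ux z) => s; exact: finite_mass_avoid_le Sx zx.
Qed.

End Limit.

(** This places compact sets where [limit_mass] is a genuine limit, finite and additive. *)
Lemma compact_sub_avoid (C : set (OFilt' K)) : compact C ->
  exists x, C `<=` ofilt'_avoid x.
Proof.
apply: (@compact_induction _ (fun A => exists x, A `<=` ofilt'_avoid x)).
- by move=> A B AB [x Bx]; exists x; exact: subset_trans Bx.
- by exists \top%O.
- move=> A B [x Ax] [y By]; exists (Order.meet x y).
  by rewrite ofilt'_avoidI; exact: setUSS.
- move=> V _; have [y Vy] := ofilt'_avoid_neq0 V.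
  have [z zy] := way_below_exists domK y.
  by exists (ofilt'_avoid z); [exact: nbhs_avoid zy Vy|exists z].
Qed.

Lemma radon_measure_exists : exists lambda : set (OFilt' K) -> \bar R,
  radon_measure lambda /\ forall x, (Phi x)%:E = lambda (ofilt'_avoid x).
Proof.
have [U [UU Ux]] := finite_mass_ultrafilter.
pose m := limit_mass U.
have cU (C D : set (OFilt' K)) : compact C -> compact D ->
    exists x, C `<=` ofilt'_avoid x /\ D `<=` ofilt'_avoid x.
  move=> /compact_sub_avoid[x Cx] /compact_sub_avoid[y Dy].
  exists (Order.meet x y); rewrite ofilt'_avoidI.
  by split=> V; [left; exact: Cx|right; exact: Dy].
have m_ge0 C : compact C -> 0 <= m C.
  by move=> /compact_sub_avoid[x Cx]; exact: limit_mass_ge0 Cx.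
have m_le C D : compact C -> compact D -> C `<=` D -> m C <= m D.
  by move=> _ /compact_sub_avoid[x Dx]; exact: limit_mass_le Dx.
have mU_le C D : compact C -> compact D -> m (C `|` D) <= m C + m D.
  move=> cC cD; have [x [Cx Dx]] := cU C D cC cD.
  exact: limit_massU_le Cx Dx.
have mU C D : compact C -> compact D -> C `&` D = set0 ->
    m (C `|` D) = m C + m D.
  by move=> cC cD; have [x [Cx Dx]] := cU C D cC cD; exact: limit_massU Cx Dx.
have hT := hausdorff_OFilt' domK topK mulK.
have lT := locally_compact_OFilt' domK topK mulK.
exists (outer_content m); split.
  exact: radon_outer_content.
move=> x; apply/eqP; rewrite eq_le; apply/andP; split.
  apply: le_ereal_inf_tmp => _ [W [oW xW] <-].
  apply: (@le_trans _ _ (m (ofilt'_avoid x))%:E).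
    by rewrite lee_fin; exact: limit_mass_avoid_ge.
  by apply: inner_content_ge => //; exact: compact_ofilt'_avoid.
have [Phi_ge0 Phi_inf _] := scottPhi.
(* Interpolate [z << y << x]: the interior of [F^y] is an open superset of [F^x], and compact sets
   inside it have mass at most [Phi z]. The infimum over [z] is then [Phi x] since Phi is conjugate
   Scott. *)
have le_z z : way_below z x ->
    (outer_content m (ofilt'_avoid x) <= (Phi z)%:E)%E.
  move=> /(way_below_interpolation domK)[y zy yx].
  have xy := ofilt'_avoid_sub_interior domK topK mulK yx.
  apply: (@le_trans _ _ (inner_content m (ofilt'_avoid y)°)).
    apply: ereal_inf_lbound; exists (ofilt'_avoid y)° => //.
    by split=> //; exact: open_interior.
  apply: ge_ereal_sup => _ [C [cC Cy] <-]; rewrite lee_fin.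
  apply: limit_mass_le_avoid zy => //.
  exact: subset_trans Cy (@interior_subset _ _).
apply/lee_addgt0Pr => e e0.
have hasinf : has_inf [set Phi z | z in [set z | way_below z x]].
  split; last by exists 0 => _ [z _ <-].
  by have [z zx] := way_below_exists domK x; exists (Phi z), z.
have [_ [z zx <-] ze] := inf_adherent e0 hasinf.
apply: le_trans (le_z z zx) _; rewrite lee_fin ltW//.
by rewrite [Phi x]Phi_inf.
Qed.

End Existence.

Theorem theorem5p6 (R : realType) (d : Order.disp_t) (K : tLatticeType d)
    (domK : is_domain K) (topK : way_below (\top%O : K) (\top%O : K))
    (mulK : multiplicative_way_below K)
    (Phi : K -> R) (Phi_ge0 : forall x, 0 <= Phi x) (Phi_top : Phi \top%O = 0) :
  (exists lambda : set (OFilt' K) -> \bar R,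
     [/\ radon_measure lambda,
         (forall x, (Phi x)%:E = lambda (ofilt'_avoid x))
       & (forall mu : set (OFilt' K) -> \bar R, radon_measure mu ->
            (forall x, (Phi x)%:E = mu (ofilt'_avoid x)) ->
            forall B, borel B -> mu B = lambda B)])
  <-> conjugate_scott Phi /\ completely_alternating Phi.
Proof.
split=> [[lambda [rl lE _]]|[sPhi aPhi]].
  split.
    exact: (conjugate_scott_measure domK topK mulK Phi_ge0 Phi_top rl).
  have [bl _ _ _] := rl.
  exact: completely_alternating_measure bl lE.
have [lambda [rl lE]] := radon_measure_exists domK topK mulK sPhi aPhi.
exists lambda; split=> // mu rmu muE.
exact: (radon_unique domK topK mulK rmu rl muE lE).
Qed.
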